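(* Let $(T_n)_{n\ge 1}$ be a uniform random recursive tree and let $R_n$ be the closeness rank of the root (vertex $1$) in $T_n$. Then $R_n$ is not persistent; that is, there do not exist integer-valued random variables $N,K$ with $\mathbb{P}(N<\infty)=\mathbb{P}(K<\infty)=1$ such that $R_n=K$ for all $n\ge N$.
   Context: A uniform random recursive tree (URRT) is a random sequence of trees $(T_n)_{n\ge 1}$ with $V(T_n)=[n]=\{1,\ldots,n\}$: $T_1$ is the single vertex $1$ (the root), and $T_{n+1}$ is obtained from $T_n$ by adding vertex $n+1$ and an edge $\{i,n+1\}$, where $i$ is chosen uniformly at random from $[n]$, independently of the past. The closeness centrality of $v\in V(T_n)$ is $\mathcal{C}_{T_n}(v)=\sum_{u\in V(T_n)\setminus\{v\}}\mathrm{dist}(v,u)$, where $\mathrm{dist}(v,u)$ is the length of the path between $v$ and $u$ in $T_n$; smaller values correspond to more central vertices. Ranking: vertices are ordered from most to least central; vertices with equal centrality value are ordered in reverse order of insertion time (if $u,v$ have equal centrality, $u$ is ranked before $v$ iff $u>v$). This gives a permutation $\gamma_n$ of $[n]$, where $\gamma_n(v)\in\{1,\ldots,n\}$ is the position of $v$ in this order (position $1$ being most central). The rank of the root is $R_n=\gamma_n(1)$. The rank of the root is called persistent if there exist integer-valued random variables $N,K$ with $\mathbb{P}(N<\infty)=\mathbb{P}(K<\infty)=1$ such that $R_n=K$ for all $n\ge N$. *)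

(* Defs.v *)
From HB Require Import structures.
From mathcomp Require Import all_boot all_order all_algebra.
From mathcomp Require Import all_classical all_reals all_analysis measurable_realfun.

Set Implicit Arguments.
Unset Strict Implicit.
Unset Printing Implicit Defensive.

Import Order.TTheory GRing.Theory Num.Theory.

Local Open Scope classical_set_scope.
Local Open Scope ring_scope.

(* A graph is given by its adjacency relation on labels in nat.  The vertex set
   of the n-th graph of a sequence is always [n] = {1, ..., n}, so it is not
   stored; functions that need it take n as an argument. *)
Definition graph := rel nat.

Definition edgeless : graph := fun _ _ => false.

Definition add_edge (e : graph) (i j : nat) : graph :=
  fun u v => [|| e u v, (u == i) && (v == j) | (u == j) && (v == i)].

(* In a tree there is exactly one simple path u :: p from u to v. *)
Definition dist (e : graph) (u v : nat) : nat :=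
  xget 0%N [set k | exists p : seq nat,
    [/\ path e u p, last u p = v, uniq (u :: p) & size p = k]].

Definition closeness (n : nat) (e : graph) (v : nat) : nat :=
  (\sum_(1 <= u < n.+1 | u != v) dist e v u)%N.

(* Equal centrality: the more recently inserted vertex comes first.  The
   relation is the reflexive closure of "ranked before", as sort expects. *)
Definition more_central (n : nat) (e : graph) : rel nat := fun u v =>
  (closeness n e u < closeness n e v)%N
  || (closeness n e u == closeness n e v) && (v <= u)%N.

Definition ranking (n : nat) (e : graph) : seq nat :=
  sort (more_central n e) (iota 1 n).

(* gamma_n(v), for v in [n]; positions are counted from 1. *)
Definition closeness_rank (n : nat) (e : graph) (v : nat) : nat :=
  (index v (ranking n e)).+1.

Section RandomTrees.
Context (d : measure_display) (Omega : measurableType d) (R : realType).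
Variable P : probability Omega R.

(* The sigma-algebra generated by T_1, ..., T_n.  Only finitely many values of
   each T_k occur, so the events {T_k = t} generate it. *)
Definition past (T : nat -> Omega -> graph) (n : nat) : set (set Omega) :=
  <<s [set A | exists k t,
        (1 <= k <= n)%N /\ A = [set w | T k w = t]] >>.

(* I_ n is the vertex to which n.+1 is attached.  T 0 and I_ 0 play no role. *)
Definition is_URRT (T : nat -> Omega -> graph) : Prop :=
  exists I_ : nat -> {RV P >-> nat},
  [/\ forall w, T 1%N w = edgeless,
      forall n w, (1 <= n)%N ->
        (1 <= I_ n w <= n)%N /\ T n.+1 w = add_edge (T n w) (I_ n w) n.+1,
      forall n i, (1 <= i <= n)%N ->
        P [set w | I_ n w = i] = (n%:R^-1)%:E
    & forall n (A : set nat) (B : set Omega), (1 <= n)%N -> past T n B ->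
        P (I_ n @^-1` A `&` B) = (P (I_ n @^-1` A) * P B)%E].

(* Integer-valued, with the value +oo allowed (finiteness is required only
   almost surely, see persistent). *)
Definition integer_valued (X : Omega -> \bar R) : Prop :=
  forall w, X w = +oo%E \/ exists z : int, X w = (z%:~R)%:E.

(* As N may be +oo on a null event, requiring the last clause for all w is the
   same as requiring it for almost all w. *)
Definition persistent (Rk : nat -> Omega -> nat) : Prop :=
  exists N K : {RV P >-> \bar R},
  [/\ integer_valued N /\ integer_valued K,
      P [set w | (N w < +oo)%E] = 1%E,
      P [set w | (K w < +oo)%E] = 1%E
    & forall w n, (1 <= n)%N -> (N w <= (n%:R)%:E)%E ->
        ((Rk n w)%:R)%:E = K w].

End RandomTrees.

(* Main.v *)
Require Import Defs.
From mathcomp Require Import all_boot all_order all_algebra.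
From mathcomp Require Import all_classical all_reals all_analysis.
From mathcomp Require Import measurable_realfun.
From mathcomp Require Import zify ring lra.

(* Suppose that 3 is attached to 2 and that at least 3/4 of the n vertices
   descend from 3 (3 included).  A child c of 3 is closer than the root by at
   least 1 to each of these, and farther by at most 3 from the others, so c is
   at least as central as the root: the rank of the root exceeds the number of
   children of 3.  With probability bounded away from 0 the proportion of
   descendants of 3 (a Polya urn) is at least 3/4 at time n, whereas the number
   of children of 3 tends to infinity in probability.  Hence the ranks are not
   tight, while persistent ranks would be. *)

Set Implicit Arguments.
Unset Strict Implicit.
Unset Printing Implicit Defensive.

Import Order.TTheory GRing.Theory Num.Theory.

(** * Counting members of a list and positions in a sorted list *)

Lemma sum_nat_mem (s : seq nat) (n : nat) :
  uniq s -> {subset s <= iota 1 n} ->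
  (\sum_(1 <= u < n.+1) (u \in s) = size s)%N.
Proof.
move=> Us sub; rewrite /index_iota subSS subn0 -(perm_size (s1 := [seq u <- iota 1 n | u \in s])).
  by rewrite -sum1_size big_filter [RHS]big_mkcond; apply: eq_bigr => u _; case: (u \in s).
rewrite uniq_perm ?filter_uniq ?iota_uniq // => u.
by rewrite mem_filter; case: (boolP (u \in s)) => //= /sub.
Qed.

(** Antisymmetry puts every member of [r] strictly before [x] in the sorted list, so [r] fits into
    the prefix that ends before [x]. *)
Lemma size_le_index (T : eqType) (leT : rel T) (s r : seq T) (x : T) :
  total leT -> transitive leT -> antisymmetric leT ->
  x \in s -> uniq r -> {subset r <= s} ->
  {in r, forall y, leT y x && (y != x)} -> size r <= index x (sort leT s).
Proof.
move=> tot tr anti xs Ur sub lex.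
rewrite -[leqRHS](size_takel (s := sort leT s)) ?index_size //.
apply: uniq_leq_size => // y yr.
have /andP[lyx nyx] := lex y yr.
have ys : y \in sort leT s by rewrite mem_sort sub.
rewrite in_take //.
rewrite ltnNge leq_eqVlt; apply/negP => /orP[/eqP exy|].
  by move: nyx; rewrite -(nth_index x ys) -exy nth_index ?mem_sort ?eqxx.
move=> /(sorted_ltn_index tr (sort_sorted tot s)).
rewrite mem_sort => /(_ xs ys) lxy.
by move: nyx; rewrite (anti y x) ?eqxx // lyx.
Qed.

Lemma more_central_total (n : nat) (e : graph) : total (more_central n e).
Proof. by move=> u v; rewrite /more_central; lia. Qed.

Lemma more_central_trans (n : nat) (e : graph) : transitive (more_central n e).
Proof. by move=> v u w; rewrite /more_central; lia. Qed.

Lemma more_central_anti (n : nat) (e : graph) : antisymmetric (more_central n e).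
Proof. by move=> u v; rewrite /more_central; lia. Qed.

(** * Simple paths in a graph where each vertex has at most one smaller neighbour *)

Section SimplePaths.

Context (e : graph).
Context (e_sym : symmetric e).
Context (e_irr : irreflexive e).
Context (e_low : forall x y z, e x y -> e x z -> y < x -> z < x -> y = z).

Let edge_neq x y : e x y -> x != y.
Proof. by move=> exy; apply/eqP => xy; rewrite xy e_irr in exy. Qed.

(** After an upward step from [z] to [x], the only smaller neighbour of [x] is [z], already visited,
    so a simple path can only keep ascending. *)
Lemma ascending_path z x p :
  e z x -> z < x -> path e x p -> uniq [:: z, x & p] -> x <= last x p.
Proof.
elim: p z x => [//|y p IH] z x ezx zx /= /andP[exy epy] /and3P[zxyp xyp Uyp].
have zy : z != y by apply: contraNneq zxyp => ->; rewrite !inE eqxx orbT.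
have xy : x < y.
  have := edge_neq exy; rewrite neq_ltn => /orP[//|yx].
  by move: zy; rewrite (@e_low x z y) ?eqxx // e_sym.
apply: leq_trans (ltnW xy) _; apply: (IH x y) => //=.
by rewrite xyp.
Qed.

Lemma descending_first_step u v p :
  path e u p -> last u p = v -> uniq (u :: p) -> v < u ->
  exists y p', [/\ p = y :: p', e u y & y < u].
Proof.
case: p => [/= _ <-|y p /= /andP[euy epy] lp /andP[nu Up] vu].
  by rewrite ltnn.
exists y, p; split=> //; have := edge_neq euy; rewrite neq_ltn => /orP[uy|//].
have := @ascending_path u y p euy uy epy; rewrite lp /= nu => /(_ Up) yv.
by move: (leq_trans uy yv); rewrite ltnNge (ltnW vu).
Qed.

Let rev_path u v p : path e u p -> last u p = v -> uniq (u :: p) ->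
  [/\ path e v (rev (belast u p)), last v (rev (belast u p)) = u,
      uniq (v :: rev (belast u p)) & size (rev (belast u p)) = size p].
Proof.
move=> ep lp Up; split.
- rewrite -lp rev_path; apply: sub_path ep => x y /=; by rewrite e_sym.
- by case: (p) lp => [//|y q] _; rewrite /= rev_cons last_rcons.
- by rewrite -[_ :: _]rev_rcons rev_uniq -lp -lastI.
- by rewrite size_rev size_belast.
Qed.

(* The largest vertex of a simple path is an endpoint, and its neighbour on the
   path is then its unique smaller neighbour: peel it off. *)
Lemma simple_path_size u v p q :
  path e u p -> last u p = v -> uniq (u :: p) ->
  path e u q -> last u q = v -> uniq (u :: q) -> size p = size q.
Proof.
have [n] := ubnP (size p); elim: n u v p q => [//|n IH] u v p q.
(* The case where the start exceeds the end is enough: reversing both paths gives the opposite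
   case. *)
have key u' v' p' q' : size p' < n.+1 -> v' < u' ->
    path e u' p' -> last u' p' = v' -> uniq (u' :: p') ->
    path e u' q' -> last u' q' = v' -> uniq (u' :: q') -> size p' = size q'.
  move=> sp vu ep lp Up eq lq Uq.
  have [y [p1 [Ep uy yu]]] := descending_first_step ep lp Up vu.
  have [z [q1 [Eq uz zu]]] := descending_first_step eq lq Uq vu.
  have yz : y = z by apply: e_low uy uz yu zu.
  subst p' q' z; move: ep lp Up eq lq Uq sp => /= /andP[_ ep] lp /andP[_ Up] /andP[_ eq] lq /andP[_ Uq] sp.
  by congr _.+1; apply: (IH y v').
move=> sp ep lp Up eq lq Uq; have [vu|uv|uv] := ltngtP v u; first exact: (key u v).
  have [ep' lp' Up' sp'] := rev_path ep lp Up.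
  have [eq' lq' Uq' sq'] := rev_path eq lq Uq.
  by rewrite -sp' -sq'; apply: (key v u) => //; rewrite sp'.
suff nil r : last u r = v -> uniq (u :: r) -> size r = 0 by rewrite !nil.
by case: r => //= y r lr; have := mem_last y r; rewrite lr uv => ->.
Qed.

Lemma dist_eq u v p : path e u p -> last u p = v -> uniq (u :: p) ->
  dist e u v = size p.
Proof.
move=> ep lp Up; rewrite /dist; case: xgetP => [k _ [q [eq lq Uq <-]]|/(_ (size p))].
  exact: simple_path_size eq lq Uq ep lp Up.
by case; exists p.
Qed.

Lemma dist_le u v p : path e u p -> last u p = v -> dist e u v <= size p.
Proof.
move=> ep; case: (shortenP ep) => q eq Uq sub lq.
by rewrite (dist_eq eq lq Uq) uniq_leq_size //; case/andP: Uq.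
Qed.

Lemma dist_witness u v p : path e u p -> last u p = v ->
  exists q, [/\ path e u q, last u q = v, uniq (u :: q) & size q = dist e u v].
Proof.
move=> ep; case: (shortenP ep) => q eq Uq _ lq.
by exists q; split=> //; rewrite (dist_eq eq lq Uq).
Qed.

Lemma dist_refl u : dist e u u = 0.
Proof. by rewrite (@dist_eq u u [::]). Qed.

Lemma closenessE n v : closeness n e v = (\sum_(1 <= u < n.+1) dist e v u)%N.
Proof.
rewrite /closeness [LHS]big_mkcond; apply: eq_bigr => u _.
by case: eqVneq => // ->; rewrite dist_refl.
Qed.

End SimplePaths.

(** * Trees encoded by their attachment histories *)

(* The history [:: i_k; ...; i_1] lists the vertices to which k.+1, ..., 2 are
   attached, most recent first. *)
Fixpoint tree_of (h : seq nat) : graph :=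
  if h is i :: h' then add_edge (tree_of h') i (size h').+2 else edgeless.

Fixpoint valid (h : seq nat) : bool :=
  if h is i :: h' then (0 < i <= (size h').+1) && valid h' else true.

Lemma tree_of_sym h : symmetric (tree_of h).
Proof.
by elim: h => [|i h IH] //= x y; rewrite /add_edge IH; congr (_ || _); rewrite orbC andbC [X in _ || X]andbC.
Qed.

Lemma tree_of_bound h x y : valid h -> tree_of h x y ->
  0 < x <= (size h).+1.
Proof.
elim: h => [//|i h IH] /= /andP[vi vh]; rewrite /add_edge => /or3P[/(IH vh)||]; lia.
Qed.

Lemma tree_of_irr h : valid h -> irreflexive (tree_of h).
Proof.
elim: h => [//|i h IH] /= /andP[vi /IH ih] x; rewrite /add_edge ih; lia.
Qed.

(** The newest vertex has a single neighbour and exceeds all older vertices, so it gives none of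
    them a second smaller neighbour. *)
Lemma tree_of_low h x y z : valid h -> tree_of h x y -> tree_of h x z ->
  y < x -> z < x -> y = z.
Proof.
elim: h => [//|i h IH] /= /andP[vi vh].
have B a b := @tree_of_bound h a b vh.
by move=> /or3P[exy|exy|exy] /or3P[exz|exz|exz];
  first (by apply: IH); try (move: (B _ _ exy)); try (move: (B _ _ exz)); lia.
Qed.

Lemma tree_of_connected h u : valid h -> 0 < u <= (size h).+1 ->
  exists2 p, path (tree_of h) 1 p & last 1 p = u.
Proof.
elim: h u => [|i h IH] u /=; first by move=> _ ?; exists [::] => //=; lia.
move=> /andP[vi vh] hu.
have mono p : path (tree_of h) 1 p -> path (add_edge (tree_of h) i (size h).+2) 1 p.
  by apply: sub_path => x y exy; rewrite /add_edge exy.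
have [uh|uh] := leqP u (size h).+1.
  by have [|p /mono ep lp] := IH u vh; [lia|exists p].
have [p ep lp] := IH i vh vi.
exists (rcons p u); last by rewrite last_rcons.
by rewrite rcons_path mono //= lp /add_edge; apply/or3P/Or32; lia.
Qed.

(** The neighbour of the newest vertex is the head of the history, and removing that edge leaves the
    tree of the tail. Thus an event fixing the history is an event fixing the tree. *)
Lemma tree_of_inj h h' : size h = size h' -> valid h -> valid h' ->
  tree_of h = tree_of h' -> h = h'.
Proof.
elim: h h' => [[]//|i h IH] [//|j h'] /= [sz] /andP[vi vh] /andP[vj vh'] E.
have B a b := @tree_of_bound h a b vh.
have B' a b := @tree_of_bound h' a b vh'.
have S a b := tree_of_sym h a b.
have S' a b := tree_of_sym h' a b.
have EE x y : add_edge (tree_of h) i (size h).+2 x y = add_edge (tree_of h') j (size h').+2 x y.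
  by rewrite E.
have ij : i = j.
  have := EE (size h).+2 i; rewrite /add_edge -sz !eqxx !orbT => /esym /or3P[/B'||]; lia.
rewrite ij (IH h') //; apply/funext => x; apply/funext => y.
apply/idP/idP => exy.
  have := EE x y; rewrite {1}/add_edge exy => /esym /or3P[//||];
  have := B _ _ exy; rewrite S in exy; have := B _ _ exy; lia.
have := EE x y; rewrite {2}/add_edge exy => /or3P[//||];
have := B' _ _ exy; rewrite S' in exy; have := B' _ _ exy; lia.
Qed.

(** * Descendants and children of a vertex [r] *)

Section Subtree.
Context (r : nat).

(** For [r > 1], the descendants of [r], itself included; the root is never listed. *)
Fixpoint subtree (h : seq nat) : seq nat :=
  if h is i :: h' then
    let s := subtree h' in
    if ((size h').+2 == r) || (i \in s) then (size h').+2 :: s else s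
  else [::].

Fixpoint children (h : seq nat) : seq nat :=
  if h is i :: h' then
    if i == r then (size h').+2 :: children h' else children h'
  else [::].

Lemma subtree_bound h x : x \in subtree h -> 1 < x <= (size h).+1.
Proof.
elim: h => [//|i h IH] /=; case: ifP => _; rewrite ?inE; first case/predU1P => [->|]; try move/IH; lia.
Qed.

Lemma subtree_uniq h : uniq (subtree h).
Proof.
elim: h => [//|i h IH] /=; case: ifP => _ //=; rewrite IH andbT.
by apply/negP => /subtree_bound; lia.
Qed.

(** A vertex other than [r] joins the subtree exactly when its parent is in it. So a path from the
    root to a descendant of [r] must enter through [r]. *)
Lemma subtree_boundary h x y : valid h -> tree_of h x y ->
  y \in subtree h -> x \notin subtree h -> y = r.
Proof.
elim: h => [//|i h IH] /= /andP[vi vh].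
have B a b := @tree_of_bound h a b vh.
have S a b := @tree_of_sym h a b.
have D a := @subtree_bound h a.
have [/orP c|/negbT] := ifP.
  rewrite !inE => /or3P[exy|exy|exy] /orP[yD|yD]; rewrite negb_or => /andP[xn xD].
  - by move: exy; rewrite S => /B; lia.
  - exact: IH xD.
  - by case: c => c; [lia|case/negP: xD; case/andP: exy => /eqP ->].
  - by have := D _ yD; lia.
  - lia.
  - lia.
rewrite negb_or => /andP[nr ni] /or3P[exy|exy|exy] yD xD.
- exact: IH xD.
- by have := D _ yD; lia.
- by case/andP: exy yD ni => _ /eqP -> ->.
Qed.

Lemma children_bound h x : valid h -> x \in children h -> r < x <= (size h).+1.
Proof.
elim: h => [//|i h IH] /= /andP[vi vh]; case: ifP => /eqP ir; rewrite ?inE; first case/predU1P => [->|]; try move/(IH vh); lia.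
Qed.

Lemma children_uniq h : valid h -> uniq (children h).
Proof.
elim: h => [//|i h IH] /= /andP[vi vh]; case: ifP => /eqP ir /=; rewrite IH // andbT.
by apply/negP => /(children_bound vh); lia.
Qed.

Lemma children_edge h x : x \in children h -> tree_of h x r.
Proof.
elim: h => [//|i h IH] /=; rewrite /add_edge; case: ifP => /eqP ir; last by move/IH ->.
by rewrite inE => /predU1P[->|/IH -> //]; rewrite ir !eqxx !orbT.
Qed.

End Subtree.

(** * Comparing the root with the children of 3 *)

Section RankBound.
Context (h : seq nat).
Context (vh : valid h).
Let n := (size h).+1.
Let e := tree_of h.
Context (e32 : e 3 2).
Context (e21 : e 2 1).

Let eS : symmetric e := @tree_of_sym h.
Let eI : irreflexive e := tree_of_irr vh.
Let eL x y z : e x y -> e x z -> y < x -> z < x -> y = z.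
Proof. exact: tree_of_low. Qed.

Let edge3 c : c \in children 3 h -> e c 3.
Proof. exact: children_edge. Qed.

(** Walk along [c], 3, 2, 1 and then from 1 to [u]. *)
Lemma dist_child_le (c u : nat) : c \in children 3 h -> 0 < u <= n ->
  dist e c u <= dist e 1 u + 3.
Proof.
move=> /edge3 ec3 hu; have [p0 ep0 lp0] := tree_of_connected vh hu.
have [p [ep lp Up <-]] := dist_witness eS eI eL ep0 lp0.
rewrite -[size p + 3]/(size p + size [:: 3; 2; 1]) addnC -size_cat.
apply: (dist_le eS eI eL); last by rewrite last_cat.
by rewrite cat_path /= ec3 e32 e21.
Qed.

(** The path from 1 to [u] passes through 3, and needs at least two edges to get there because the
    only smaller neighbour of 3 is 2; [c] reaches 3 in one edge. *)
Lemma dist_child_lt (c u : nat) : c \in children 3 h -> u \in subtree 3 h ->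
  dist e c u < dist e 1 u.
Proof.
move=> /edge3 ec3 uD; have hu : 0 < u <= n by have := subtree_bound uD; rewrite /n; lia.
have [p0 ep0 lp0] := tree_of_connected vh hu.
have [p [ep lp Up <-]] := dist_witness eS eI eL ep0 lp0.
have cut x q : path e x q -> x \notin subtree 3 h -> last x q \in subtree 3 h -> 3 \in q.
  elim: q x => [x _ /negbTE /= -> //|y q IH x /= /andP[exy eq] xD lD].
  rewrite inE; have [yD|yD] := boolP (y \in subtree 3 h).
    by rewrite -(subtree_boundary vh exy yD xD) eqxx.
  by rewrite (IH y) ?orbT.
have p3 : 3 \in p.
  by apply: (cut 1) => //; [apply/negP => /subtree_bound|rewrite lp].
case/splitPr: p3 ep lp {Up} => p1 p2; rewrite cat_path last_cat size_cat /= => /and3P[_ el ep2] lp2.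
have p1_gt0 : 0 < size p1.
  case: p1 el => //= e13; suff: 2 = 1 by [].
  by apply: (@eL 3) => //; rewrite eS.
suff /leq_ltn_trans: dist e c u <= (size p2).+1.
  by apply; rewrite -[ltnLHS]add0n ltn_add2r.
apply: (@dist_le e eS eI eL c u (3 :: p2)) => //=.
by rewrite ec3.
Qed.

(** Both distance bounds say [dist e c u + 4 * (u \in D) <= dist e 1 u + 3]. Summed over [u], the
    correction is [3 * n - 4 * size D], which is not positive under the assumption. *)
Lemma closeness_child_le (c : nat) : c \in children 3 h ->
  3 * (n - size (subtree 3 h)) <= size (subtree 3 h) ->
  closeness n e c <= closeness n e 1.
Proof.
move=> ch; set D := subtree 3 h => big.
rewrite !(closenessE eS eI eL).
have sD : \sum_(1 <= u < n.+1) 4 * (u \in D) = 4 * size D.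
  rewrite -big_distrr sum_nat_mem ?subtree_uniq // => u /subtree_bound; rewrite mem_iota /n; lia.
have : \sum_(1 <= u < n.+1) (dist e c u + 4 * (u \in D)) <=
       \sum_(1 <= u < n.+1) (dist e 1 u + 3).
  rewrite !big_nat; apply: leq_sum => u hu.
  have [uD|_] := boolP (u \in D).
    by have := dist_child_lt ch uD; lia.
  by have := @dist_child_le c u ch; lia.
rewrite big_split [leqRHS]big_split /= sD sum_nat_const_nat; lia.
Qed.

(** Equal centrality suffices, since ties favour the later vertex and every child of 3 is later than
    1. *)
Lemma children_lt_rank :
  3 * (n - size (subtree 3 h)) <= size (subtree 3 h) ->
  size (children 3 h) < closeness_rank n e 1.
Proof.
move=> big; rewrite /closeness_rank ltnS /ranking.
have cb x := @children_bound 3 h x vh.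
apply: size_le_index (@more_central_total n e) (@more_central_trans n e) (@more_central_anti n e) _ (children_uniq 3 vh) _ _.
- by rewrite mem_iota /n; lia.
- by move=> x /cb; rewrite mem_iota /n; lia.
move=> c ch; have := closeness_child_le ch big; have := cb _ ch.
rewrite /more_central; lia.
Qed.

End RankBound.

(** * Bounds for the chain of histories: the subtree and the children of 3 *)

Section Growth.
Local Open Scope ring_scope.
Context {R : realType}.

(* The transition operator of the Markov chain of histories. *)
Definition avg (g : seq nat -> R) (h : seq nat) : R :=
  (size h).+1%:R^-1 * \sum_(1 <= i < (size h).+2) g (i :: h).

Lemma ler_avg f g h : (forall i, f (i :: h) <= g (i :: h)) -> avg f h <= avg g h.
Proof. by move=> fg; rewrite ler_wpM2l ?invr_ge0 // ler_sum. Qed.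

Definition outside (h : seq nat) : nat := ((size h).+1 - size (subtree 3 h))%N.

Lemma size_subtree r h : (size (subtree r h) <= size h)%N.
Proof. by elim: h => [//|i h IH] /=; case: ifP => _ /=; lia. Qed.

(** With [n] vertices, [outside h] of the [n] possible parents raise the count by 1, giving
    [n * outside h + outside h]. Hence [outside] over the number of vertices is harmonic. As
    [1 < size h], the new vertex is not 3 itself. *)
Lemma sum_outside h : (1 < size h)%N ->
  (\sum_(1 <= i < (size h).+2) outside (i :: h) = (size h).+2 * outside h)%N.
Proof.
move=> h2; set D := subtree 3 h; have sD : (size D <= size h)%N := size_subtree 3 h.
have mD : (\sum_(1 <= i < (size h).+2) (i \in D) = size D)%N.
  rewrite sum_nat_mem ?subtree_uniq // => u /subtree_bound; rewrite mem_iota; lia.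
have : (\sum_(1 <= i < (size h).+2) (outside (i :: h) + (i \in D)) =
        \sum_(1 <= i < (size h).+2) (outside h).+1)%N.
  apply: eq_bigr => i _; rewrite /outside /=.
  have -> : ((size h).+2 == 3)%N = false by lia.
  by rewrite /= -/D; case: (i \in D) => /=; lia.
rewrite big_split mD sum_nat_const_nat subSS subn0; set S := bigop.body _ _ _.
by rewrite /outside -/D -[LHS]/(S + size D)%N; nia.
Qed.

(** With fewer than [M] children, [2 ^+ M * half_pow h] exceeds 1, which makes Markov's inequality
    applicable. *)
Definition half_pow (h : seq nat) : R := 2^-1 ^+ size (children 3 h).

Lemma half_pow_gt0 h : 0 < half_pow h.
Proof. by rewrite exprn_gt0 ?invr_gt0. Qed.

Lemma sum_half_pow h : (1 < size h)%N ->
  \sum_(1 <= i < (size h).+2) half_pow (i :: h) =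
  ((size h).+1%:R - 2^-1) * half_pow h.
Proof.
move=> h2; have -> : \sum_(1 <= i < (size h).+2) half_pow (i :: h) =
  \sum_(1 <= i < (size h).+2) (half_pow h - 2^-1 * half_pow h * (i \in [:: 3])%:R).
  apply: eq_bigr => i _; rewrite /half_pow /= inE; case: eqP => _ /=.
    by rewrite exprS; lra.
  by rewrite mulr0 subr0.
rewrite big_split sumr_const_nat /= sumrN -mulr_sumr -natr_sum sum_nat_mem //.
  by rewrite subSS subn0 -mulr_natr /=; lra.
by move=> u; rewrite mem_seq1 mem_iota => /eqP ->; lia.
Qed.

Definition good (M : nat) (h : seq nat) : bool :=
  (3 * outside h <= size (subtree 3 h))%N && (M <= size (children 3 h))%N.

(** For [n > 0], an upper bound for the product of [1 - 1/(2m)] over [n <= m < n + k]: the square of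
    each factor is at most [m/(m+1)], and these quotients telescope. *)
Definition decay (n k : nat) : R := Num.sqrt (n%:R / (n + k)%:R).

Lemma decay_step n k :
  (1 - 2^-1 / n.+1%:R) * decay n.+2 k <= decay n.+1 k.+1.
Proof.
rewrite /decay addSnnS; set m : R := (_ + _)%:R.
have m0 : 0 < m by rewrite ltr0n.
have n0 : (0 : R) < n.+1%:R by [].
set x : R := n.+1%:R in n0 *; have -> : n.+2%:R = x + 1 :> R by rewrite -natr1.
have x1 : 1 <= x by rewrite ler1n.
have y0 : 0 <= 1 - 2^-1 / x.
  by rewrite subr_ge0 ler_pdivrMr //; lra.
rewrite -(ger0_norm y0) -sqrtr_sqr -sqrtrM ?sqr_ge0 // ler_sqrt; last by rewrite divr_ge0 // ltW.
rewrite mulrA ler_pM2r ?invr_gt0 //.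
(* Clearing [x^-2] reduces the squared claim to [(x - 1/2)^2 (x + 1) <= x^3]. *)
have -> : x = x^-2 * x ^+ 3 by field; lra.
have -> : (1 - 2^-1 / (x^-2 * x ^+ 3)) ^+ 2 * (x^-2 * x ^+ 3 + 1) = x^-2 * ((x - 2^-1)^+2 * (x + 1)) by field; lra.
rewrite ler_pM2l ?invr_gt0 ?exprn_gt0 //; nra.
Qed.

(* Union bound and Markov's inequality, for the harmonic function [outside / n]
   and for [half_pow]: a new vertex is attached to 3 with
   probability [1 / n], so the mean of [half_pow] shrinks by [1 - 1 / (2 n)]. *)
Lemma iter_avg_good M k h : (1 < size h)%N ->
  1 - 4 * (outside h)%:R / (size h).+1%:R
    - 2 ^+ M * half_pow h * decay (size h).+1 k
  <= iter k avg (fun h' => (good M h')%:R) h.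
Proof.
elim: k h => [|k IH] h h2.
  rewrite /= /decay addn0 divff ?pnatr_eq0 // sqrtr1 mulr1.
  set A : R := 4 * _ / _; set B := 2 ^+ M * half_pow h.
  have A0 : 0 <= A by rewrite divr_ge0 ?mulr_ge0.
  have B0 : 0 <= B by rewrite mulr_ge0 ?exprn_ge0 ?ltW ?half_pow_gt0.
  (* If [good] fails, a subtracted term is at least 1: [A] when [4 * outside h] exceeds the number
     of vertices, [B] when there are fewer than [M] children. *)
  rewrite /good; case: leqP => /= D; last first.
    suff : 1 <= A by move=> ?; rewrite mulr0n; lra.
    rewrite ler_pdivlMr // mul1r -natrM ler_nat.
    by have := size_subtree 3 h; rewrite /outside in D *; lia.
  case: leqP => /= C; first by rewrite mulr1n; lra.
  suff : 1 <= B by move=> ?; rewrite mulr0n; lra.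
  rewrite /B /half_pow exprVn ler_pdivlMr ?exprn_gt0 // mul1r.
  by rewrite ler_eXn2l // ?ltr1n // ltnW.
rewrite iterS.
pose b h' : R := 1 - 4 * (outside h')%:R / (size h').+1%:R
    - 2 ^+ M * half_pow h' * decay (size h').+1 k.
apply: (@le_trans _ _ (avg b h)); last by apply: ler_avg => i; apply: IH; rewrite /=; lia.
(* The average is exact: the first term is harmonic, and the second gains a factor that [decay_step]
   absorbs. *)
have -> : avg b h = 1 - 4 * (outside h)%:R / (size h).+1%:R
    - 2 ^+ M * half_pow h * ((1 - 2^-1 / (size h).+1%:R) * decay (size h).+2 k).
  rewrite /avg /b /= big_split big_split /= !sumrN sumr_const_nat.
  rewrite -!mulr_suml -!mulr_sumr -natr_sum sum_outside // sum_half_pow // natrM subSS subn0.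
  field.
  by rewrite nat1r -natrD !pnatr_eq0.
rewrite lerD2l lerN2; apply: ler_wpM2l (decay_step _ _).
by rewrite mulr_ge0 ?exprn_ge0 // ltW ?half_pow_gt0.
Qed.

Lemma decay_small n (eps : R) : 0 < eps ->
  exists k0, forall k, (k0 <= k)%N -> decay n k <= eps.
Proof.
(* The quotient [n / (n + k)] is at most [eps ^+ 2] once [k >= n / eps ^+ 2]; the successor keeps
   [n + k] positive. *)
move=> e0; exists (Num.bound (n%:R / eps ^+ 2)).+1 => k kb.
have nk0 : (0 : R) < (n + k)%:R by rewrite ltr0n; lia.
rewrite /decay -[leRHS]ger0_norm ?(ltW e0) // -sqrtr_sqr ler_sqrt ?sqr_ge0 //.
rewrite ler_pdivrMr // mulrC -ler_pdivrMr ?exprn_gt0 //.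
apply: le_trans (ltW (archi_boundP _)) _; first by rewrite divr_ge0 ?sqr_ge0.
by rewrite ler_nat (leq_trans _ (leq_addl _ _)) // ltnW.
Qed.

End Growth.

(** * Tails of almost surely finite variables *)

Section Tightness.
Local Open Scope classical_set_scope.
Local Open Scope ring_scope.
Context d (Omega : measurableType d) (R : realType) (P : probability Omega R).

Lemma measurable_gt (X : {RV P >-> \bar R}) (n : nat) :
  measurable [set w | (n%:R%:E < X w)%E].
Proof.
rewrite -[X in measurable X]setTI.
by apply: emeasurable_fun_o_infty => //; exact: measurable_funP.
Qed.

(** The events [X <= n] increase to [X < +oo], so continuity from below applies. *)
Lemma finite_tail (X : {RV P >-> \bar R}) (eps : R) :
  P [set w | (X w < +oo)%E] = 1%E -> 0 < eps ->
  exists m : nat, forall n, (m <= n)%N ->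
    (P [set w | (n%:R%:E < X w)%E] < eps%:E)%E.
Proof.
move=> X1 e0; pose F n := ~` [set w | (n%:R%:E < X w)%E].
have mF n : measurable (F n) by apply: measurableC; exact: measurable_gt.
have FU : \bigcup_n F n = [set w | (X w < +oo)%E].
  apply/seteqP; split=> w /=.
    by move=> [n _ /negP]; rewrite -leNgt => /le_lt_trans; apply; exact: ltry.
  case Xr: (X w) => [r| |] //= _.
    exists (Num.bound `|r|) => //; rewrite /F /= Xr; apply/negP; rewrite -leNgt lee_fin.
    exact: le_trans (ler_norm _) (ltW (archi_boundP _)).
  by exists 0%N => //; rewrite /F /= Xr.
have ndF : {homo F : n m / (n <= m)%N >-> (n <= m)%O}.
  move=> n m nm; apply/subsetPset => w /= /negP; rewrite -leNgt => Xn.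
  by apply/negP; rewrite -leNgt (le_trans Xn) // lee_fin ler_nat.
have : P (F n) @[n --> \oo] --> 1%E.
  by rewrite -X1 -FU; apply: nondecreasing_cvg_mu => //; exact: bigcupT_measurable.
move=> /fine_cvgP[_ /cvgr_gt /(_ (1 - eps))] [|m _ mP]; first by lra.
exists m => n /mP /=; rewrite probability_setC; last exact: measurable_gt.
by rewrite -(fineK (fin_num_measure P _ (measurable_gt X n))) lte_fin /=; lra.
Qed.

End Tightness.

(** * The law of the history, and the contradiction with persistence *)

Section History.
Local Open Scope classical_set_scope.
Local Open Scope ring_scope.
Context d (Omega : measurableType d) (R : realType) (P : probability Omega R).
Context (T : nat -> Omega -> graph) (I_ : nat -> {RV P >-> nat}).
Context (T1 : forall w, T 1%N w = edgeless).
Context (TS : forall n w, (1 <= n)%N ->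
  (1 <= I_ n w <= n)%N /\ T n.+1 w = add_edge (T n w) (I_ n w) n.+1).
Context (I_unif : forall n i, (1 <= i <= n)%N ->
  P [set w | I_ n w = i] = (n%:R^-1)%:E).
Context (I_indep : forall n (A : set nat) (B : set Omega), (1 <= n)%N ->
  past T n B -> P (I_ n @^-1` A `&` B) = (P (I_ n @^-1` A) * P B)%E).

Fixpoint history (k : nat) (w : Omega) : seq nat :=
  if k is k'.+1 then I_ k w :: history k' w else [::].

Lemma size_history k w : size (history k w) = k.
Proof. by elim: k => //= k ->. Qed.

Lemma valid_history k w : valid (history k w).
Proof.
elim: k => //= k ->; rewrite size_history andbT.
by have [|//] := @TS k.+1 w.
Qed.

Lemma tree_of_history k w : T k.+1 w = tree_of (history k w).
Proof.
elim: k => [|k IH]; first exact: T1.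
by have [//|_ ->] := @TS k.+1 w; rewrite IH /= size_history.
Qed.

Lemma tree_of_history_mono j k w x y :
  tree_of (history j w) x y -> tree_of (history (k + j) w) x y.
Proof. by move=> e; elim: k => //= k IH; rewrite /add_edge IH. Qed.

Lemma measurable_history k (Q : seq nat -> Prop) :
  measurable [set w | Q (history k w)].
Proof.
elim: k Q => [|k IH] Q /=.
  have [q|q] := pselect (Q [::]).
    by rewrite (_ : [set _ | _] = setT) //; apply/seteqP; split.
  by rewrite (_ : [set _ | _] = set0) //; apply/seteqP; split.
rewrite (_ : [set _ | _] = \bigcup_i (I_ k.+1 @^-1` [set i] `&`
    [set w | Q (i :: history k w)])); last first.
  apply/seteqP; split=> w /=; first by exists (I_ k.+1 w).
  by move=> [i _ [/= <-]].
apply: bigcupT_measurable => i; apply: measurableI; last exact: (IH (fun h => Q (i :: h))).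
by rewrite -[X in measurable X]setTI; exact: measurable_funP.
Qed.

Lemma drop_history j k w : drop k (history (k + j) w) = history j w.
Proof. by elim: k => [|k IH] //=; rewrite drop0. Qed.

Lemma measurable_history2 j k (h : seq nat) (g : pred (seq nat)) :
  measurable [set w | history j w = h /\ g (history (k + j) w)].
Proof.
rewrite (_ : [set _ | _] =
    [set w | drop k (history (k + j) w) = h /\ g (history (k + j) w)]).
  exact: (measurable_history (k + j) (fun h' => drop k h' = h /\ g h')).
by apply/seteqP; split=> w; rewrite /= drop_history.
Qed.

Lemma past_history h : valid h ->
  past T (size h).+1 [set w | history (size h) w = h].
Proof.
move=> vh; apply: sub_gen_smallest; exists (size h).+1, (tree_of h); split; first by lia.
apply/seteqP; split=> w /=; rewrite tree_of_history; first by move=> ->.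
by move/tree_of_inj; apply; rewrite ?size_history ?valid_history.
Qed.

Lemma prob_history_eq h : valid h ->
  P [set w | history (size h) w = h] = ((size h)`!%:R^-1)%:E.
Proof.
elim: h => [_|i h IH /= /andP[vi vh]].
  rewrite (_ : [set _ | _] = setT); last by apply/seteqP; split.
  by rewrite probability_setT fact0 invr1.
rewrite (_ : [set _ | _] = I_ (size h).+1 @^-1` [set i] `&`
    [set w | history (size h) w = h]); last first.
  apply/seteqP; split=> w /=; first by move=> [-> ->].
  by move=> [-> ->].
rewrite I_indep //; last exact: past_history.
by rewrite I_unif // IH // -EFinM factS natrM invfM.
Qed.

(** The Markov property: a valid history of length [m] has probability [1/m!], and [iter k avg] is
    the conditional probability of [g] after [k] more steps. *)
Lemma prob_history h k (g : pred (seq nat)) : valid h ->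
  P [set w | history (size h) w = h /\ g (history (k + size h) w)] =
  ((size h)`!%:R^-1 * iter k avg (fun h' => (g h')%:R) h)%:E.
Proof.
elim: k h => [|k IH] h vh.
  rewrite /= add0n; case: (boolP (g h)) => gh.
    rewrite mulr1 -prob_history_eq //; congr (P _).
    by apply/seteqP; split=> w /= => [[]|->].
  rewrite mulr0 (_ : [set _ | _] = set0) ?measure0 //.
  by apply/seteqP; split=> w //= [->]; exact/negP.
pose A i := [set w | history (size (i :: h)) w = i :: h /\
                     g (history (k + size (i :: h)) w)].
(* Split according to the next parent, with indices shifted since parents start at 1. *)
have -> : [set w | history (size h) w = h /\ g (history (k.+1 + size h) w)] =
    \big[setU/set0]_(i < (size h).+1) A i.+1.
  rewrite -(bigcup_mkord _ (fun i => A i.+1)); apply/seteqP; split=> w.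
    move=> [/= hw gw]; have [//|Ib _] := @TS (size h).+1 w.
    exists (I_ (size h).+1 w).-1; first by rewrite /=; lia.
    by rewrite /A /= hw prednK ?addnS //; case/andP: Ib.
  by move=> [i _ [/= [Ii hw]]]; rewrite addnS.
rewrite measure_bigsetU_ord; last 2 first.
- by move=> i; exact: measurable_history2.
- move=> i j _ _ [w [[/= [Ii _] _] [[/= [Ij _] _]]]].
  by apply/val_inj/eq_add_S; rewrite -Ii -Ij.
transitivity (\sum_(i < (size h).+1)
  ((size h).+1`!%:R^-1 * iter k avg (fun h' => (g h')%:R : R) (i.+1 :: h))%:E)%E.
  by apply: eq_bigr => i _; apply: (IH (i.+1 :: h)); rewrite /= vh ltn_ord.
rewrite sumEFin -mulr_sumr iterS /avg big_add1 big_mkord factS natrM invfM.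
by congr EFin; rewrite mulrCA mulrA.
Qed.

(** A rank above [M] at a late time forces [N] to exceed that time or [K] to exceed [M]. Working
    with measurable subsets [A] avoids proving the rank event measurable. *)
Lemma persistent_lt_rank_small (eps : R) :
  0 < eps -> persistent P (fun n w => closeness_rank n (T n w) 1) ->
  exists M n0 : nat, forall n, (n0 <= n)%N ->
    forall A : set Omega, measurable A ->
    A `<=` [set w | (M < closeness_rank n.+1 (T n.+1 w) 1)%N] ->
    (P A < eps%:E)%E.
Proof.
move=> e0 [N [K [_ N1 K1 NK]]]; have e2 : 0 < eps / 2 by lra.
have [n0 tailN] := finite_tail N1 e2; have [M tailK] := finite_tail K1 e2.
exists M, n0 => n n0n A mA AM.
set B := [set w | (n.+1%:R%:E < N w)%E]; set C := [set w | (M%:R%:E < K w)%E].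
have mB : measurable B by exact: measurable_gt.
have mC : measurable C by exact: measurable_gt.
have : A `<=` B `|` C.
  move=> w /AM /= Mr; rewrite /B /C /=; have [Nn|nN] := leP (N w) n.+1%:R%:E; last by left.
  by right; rewrite -(NK w n.+1) // lte_fin ltr_nat.
move=> /(le_measure P); rewrite !inE => /(_ mA (measurableU _ _ mB mC)) PA.
apply: le_lt_trans PA _; apply: le_lt_trans (measureU2 P mB mC) _.
by rewrite [eps]splitr EFinD lteD ?tailN ?tailK // ltnW.
Qed.

Lemma not_persistent : ~ persistent P (fun n w => closeness_rank n (T n w) 1).
Proof.
(* Of these 16 vertices, 14 descend from 3: Markov's inequality then loses only
   4 * 2 / 16 = 1 / 2. *)
pose h0 := (nseq 13 3 ++ [:: 2; 1])%N.
have vh0 : valid h0 by [].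
(* [c] is the probability that the history starts with [h0]. *)
pose c : R := 15`!%:R^-1; have c0 : 0 < c by rewrite invr_gt0 ltr0n fact_gt0.
move=> /(@persistent_lt_rank_small (c / 4)) [|M [n0 small]]; first by lra.
(* As [half_pow h0 <= 1], this makes the second loss at most 1/4; given [h0], [good] then has
   probability at least [1 - 1/2 - 1/4], which contradicts the bound [c / 4]. *)
have [k0 dk0] := @decay_small R 16 (2 ^- M / 4) ltac:(by rewrite divr_gt0 // invr_gt0 exprn_gt0).
pose k := maxn k0 n0.
have := small (k + 15)%N ltac:(lia) _ (measurable_history2 15 k h0 (good M)).
have -> : (P [set w | history 15 w = h0 /\ good M (history (k + 15) w)] =
   (c * iter k avg (fun h' => (good M h')%:R) h0)%:E)%E.
  exact: (prob_history k (good M) vh0).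
suff rank_large : [set w | history 15 w = h0 /\ good M (history (k + 15) w)]
    `<=` [set w | (M < closeness_rank (k + 15).+1 (T (k + 15).+1 w) 1)%N].
  move=> /(_ rank_large); rewrite lte_fin ltr_pM2l //; apply/negP; rewrite -leNgt.
  have := @iter_avg_good R M k h0 isT; apply: le_trans.
  have -> : outside h0 = 2%N by [].
  have hp1 : half_pow h0 <= 1 :> R by rewrite exprn_ile1 // ?invr_ge0 // invf_le1 // ler1n.
  have dk : 2 ^+ M * half_pow h0 * decay 16 k <= 4^-1 :> R.
    apply: (@le_trans _ _ (2 ^+ M * 1 * (2 ^- M / 4))); last first.
      by rewrite mulr1 mulrA divff ?mul1r // expf_neq0.
    apply: ler_pM; last by apply: dk0; lia.
    - by rewrite mulr_ge0 ?exprn_ge0 // ltW ?half_pow_gt0.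
    - exact: sqrtr_ge0.
    - by rewrite ler_wpM2l ?exprn_ge0.
  rewrite -[leRHS]/(1 - 4 * 2 / 16 - 2 ^+ M * half_pow h0 * decay 16 k); lra.
move=> w [hw /andP[D C]]; rewrite /mkset tree_of_history.
have vh := valid_history (k + 15) w.
rewrite -{1}(size_history (k + 15) w); apply: leq_ltn_trans C _.
(* The edges from 3 to 2 and from 2 to 1 are present in the tree of [h0] and persist. *)
by apply: children_lt_rank => //; apply: tree_of_history_mono; rewrite hw.
Qed.

End History.

Theorem theorem33 (d : measure_display) (Omega : measurableType d)
  (R : realType) (P : probability Omega R)
  (T : nat -> Omega -> graph) (hT : is_URRT P T) :
  ~ persistent P (fun n w => closeness_rank n (T n w) 1).
Proof.
by have [I_ [T1 TS I_unif I_indep]] := hT; exact: not_persistent T1 TS I_unif I_indep.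
Qed.
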